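(* Let $\{\eta(k),\ k=0,1,\dots\}$ be a Markov chain on $\mathbb{N}=\{1,\dots,N\}$ with transition probabilities $s_{ij}(k)=\Pr(\eta(k+1)=j\mid\eta(k)=i)$ and distributions $\upsilon_i(k)=\Pr(\eta(k)=i)$, $i,j\in\mathbb{N}$, $k\ge 0$. Let $\theta(k)=\eta(\ell-k)$ for $k=0,1,\dots,\ell$, let $\mathbb{C}_0,\mathbb{C}_\ell\subseteq\mathbb{N}$, and let $E_{\mathrm o}$ be the information $\{\theta(0)\in\mathbb{C}_0\}$ and $\{\theta(\ell)\in\mathbb{C}_\ell\}$. Define $$p_{ij}(k)=\Pr(\theta(k)=j\mid\theta(k+1)=i,\,E_{\mathrm o}),\quad 0\le k\le\ell-1,\qquad \pi_i(k)=\Pr(\theta(k)=i\mid E_{\mathrm o}),\quad 0\le k\le\ell,$$ let $\mathbf{P}(k)$ be the $N\times N$ matrix with components $p_{ij}(k)$, let $\pi(k)$ be the vector with components $\pi_i(k)$, and put $$e=\sum_{r\in\mathbb{C}_\ell}\sum_{j\in\mathbb{C}_0}[\mathbf{S}^{\ell}]_{rj}\,\upsilon_r(0),\qquad g_i(k)=\sum_{r\in\mathbb{C}_0}[\mathbf{S}^{k+1}]_{ir},$$ where $\mathbf{S}^m$ is the $m$-step transition matrix described in the context. Consider the formula $$p_{ij}(k)=\begin{cases}(g_i(k))^{-1}\displaystyle\sum_{r\in\mathbb{C}_0}[\mathbf{S}^{k}]_{jr}\,s_{ij}(k), & g_i(k)\neq 0,\\ \text{arbitrary}, & \text{otherwise.}\end{cases}\qquad(\ast)$$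 Then the following hold. 1. For $1\le k\le\ell-2$ and $i,j\in\mathbb{N}$: if $i$ is such that $\upsilon_i(\ell-k-1)>0$, then $(\ast)$ holds; if $\upsilon_i(\ell-k-1)=0$, then $p_{ij}(k)$ is arbitrary. 2. $(\ast)$ is also valid for $k=\ell-1$, $i\in\mathbb{C}_\ell$ and $j\in\mathbb{N}$, as well as for $k=0$, $i\in\mathbb{N}$ and $j\in\mathbb{C}_0$. 3. The remaining cases for $p_{ij}(k)$ are: $p_{ij}(\ell-1)$ is arbitrary for $i\notin\mathbb{C}_\ell$ and $j\in\mathbb{N}$; if $i\in\mathbb{C}_\ell$ and no Markov state $\eta(\ell)\in\mathbb{C}_0$ can be reached from $i$ (in the sense that $\Pr(\eta(\ell)\in\mathbb{C}_0\mid\eta(0)=i)=0$), then $p_{ij}(\ell-1)$ is arbitrary; and $p_{ij}(0)$ is arbitrary for $i\in\mathbb{N}$ and $j\notin\mathbb{C}_0$. 4. For $i\in\mathbb{C}_\ell$, $$\pi_i(\ell)=\begin{cases}e^{-1}\displaystyle\sum_{j\in\mathbb{C}_0}[\mathbf{S}^{\ell}]_{ij}\,\upsilon_i(0), & e\neq 0,\\ \text{arbitrary}, & \text{otherwise,}\end{cases}$$ and for $i\notin\mathbb{C}_\ell$, $\pi_i(\ell)=0$. 5. Finally, $\pi(k)$, $1\le k\le\ell-1$, is given by the Chapman-Kolmogorov equation $$\pi(k+1)=\mathbf{P}(k)\,\pi(k)$$ and the formulas above.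
   Context: The state space is the finite set $\mathbb{N}=\{1,\dots,N\}$. The chain $\eta$ is not assumed to be time-homogeneous. The process $\theta$ is the time reversal of the chain in the finite window $\{0,\dots,\ell\}$. The information $E_{\mathrm o}$ consists of cluster observations at the extremes of the window: $\theta(0)=\eta(\ell)\in\mathbb{C}_0$, and, with anticipation, $\theta(\ell)=\eta(0)\in\mathbb{C}_\ell$. For $0\le m\le\ell$, $\mathbf{S}^m$ denotes the $N\times N$ matrix of $m$-step transition probabilities up to time $\ell$, with $(j,r)$ entry $[\mathbf{S}^m]_{jr}=\Pr(\eta(\ell)=r\mid\eta(\ell-m)=j)$; thus $\mathbf{S}^0$ is the identity, and if the chain is time-homogeneous with transition matrix $\mathbf{S}$, then $\mathbf{S}^m$ is its $m$-th power. The word ''arbitrary'' means that any value may be assigned to the quantity (for instance zero); a conditional probability given an event of probability zero is regarded as arbitrary.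
   Formalization: In (∗) the factor s_ij(k) becomes s_ij(ℓ−k−1); item 5 becomes π(k)=π(k+1)P(k) for row vectors (when e≠0); in item 3, ''p_ij(0) arbitrary for j∉C_0'' becomes: 0 is a value, and any choice leaves the conditional law of compliant trajectories unchanged. *)

(* Defs.v *)
From mathcomp Require Import all_boot all_order all_algebra.
From mathcomp Require Import all_classical all_reals all_analysis.

Set Implicit Arguments.
Unset Strict Implicit.
Unset Printing Implicit Defensive.
Import Order.TTheory GRing.Theory Num.Theory.
Local Open Scope classical_set_scope.
Local Open Scope ring_scope.

(* The values that Pr(A | B) may take: a conditional probability given an event
   of probability zero is arbitrary, so in that case every real number is one.
   When P B is not zero this is the singleton of P(A `&` B) / P(B). *)
Definition cprob d (T : measurableType d) (R : realType) (P : probability T R)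
    (A B : set T) : set R :=
  [set x | P B != 0%E -> x = fine (P (A `&` B)) / fine (P B)].

Definition arbitrary (R : realType) (V : set R) : Prop := V = setT.

(* Possibly time-inhomogeneous; the history is quantified through a sequence x
   of which only the terms x 0, ..., x k matter. *)
Definition markov_chain d (T : measurableType d) (R : realType)
    (P : probability T R) (N : nat) (eta : nat -> T -> 'I_N) : Prop :=
  (forall k i, measurable [set t | eta k t = i]) /\
  (forall (k : nat) (x : nat -> 'I_N) (j : 'I_N),
     let history := [set t | forall m, (m <= k)%N -> eta m t = x m] in
     let next := [set t | eta k.+1 t = j] in
     let current := [set t | eta k t = x k] in
     P history != 0%E ->
     fine (P (next `&` history)) / fine (P history) =
     fine (P (next `&` current)) / fine (P current)).

Definition distribution_at d (T : measurableType d) (R : realType)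
    (P : probability T R) (N : nat) (eta : nat -> T -> 'I_N) (k : nat)
    (i : 'I_N) : R :=
  fine (P [set t | eta k t = i]).

(* Rows belonging to states of probability zero are left unconstrained. *)
Definition transition_probabilities d (T : measurableType d) (R : realType)
    (P : probability T R) (N : nat) (eta : nat -> T -> 'I_N)
    (s : nat -> 'M[R]_N) : Prop :=
  forall k i j,
    cprob P [set t | eta k.+1 t = j] [set t | eta k t = i] (s k i j).

Definition transitions_up_to d (T : measurableType d) (R : realType)
    (P : probability T R) (N : nat) (eta : nat -> T -> 'I_N) (ell : nat)
    (S : nat -> 'M[R]_N) : Prop :=
  S 0%N = 1%:M /\
  (forall m j r, (m <= ell)%N ->
     cprob P [set t | eta ell t = r] [set t | eta (ell - m)%N t = j] (S m j r)).

(* Only meaningful for k <= ell. *)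
Definition reversal (T U : Type) (eta : nat -> T -> U) (ell : nat) :
    nat -> T -> U :=
  fun k => eta (ell - k)%N.

Definition extremes (T : Type) (N : nat) (theta : nat -> T -> 'I_N) (ell : nat)
    (C0 Cl : {set 'I_N}) : set T :=
  [set t | theta 0%N t \in C0 /\ theta ell t \in Cl].

Definition backward_transition d (T : measurableType d) (R : realType)
    (P : probability T R) (N : nat) (theta : nat -> T -> 'I_N) (E : set T)
    (k : nat) (i j : 'I_N) : set R :=
  cprob P [set t | theta k t = j] ([set t | theta k.+1 t = i] `&` E).

Definition conditional_distribution d (T : measurableType d) (R : realType)
    (P : probability T R) (N : nat) (theta : nat -> T -> 'I_N) (E : set T)
    (k : nat) (i : 'I_N) : set R :=
  cprob P [set t | theta k t = i] E.

Definition norm_e (R : realType) (N : nat) (S : nat -> 'M[R]_N)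
    (upsilon0 : 'I_N -> R) (ell : nat) (C0 Cl : {set 'I_N}) : R :=
  \sum_(r in Cl) \sum_(j in C0) S ell r j * upsilon0 r.

Definition norm_g (R : realType) (N : nat) (S : nat -> 'M[R]_N)
    (C0 : {set 'I_N}) (k : nat) (i : 'I_N) : R :=
  \sum_(r in C0) S k.+1 i r.

(* V is the set of values of p_ij(k). The step of theta from time k+1 to time k
   is the step of eta from time ell-k-1 to time ell-k, whence the time argument
   of s; if the chain is time-homogeneous this factor is also s_ij(k). *)
Definition bridge_formula (R : realType) (N : nat) (s S : nat -> 'M[R]_N)
    (ell : nat) (C0 : {set 'I_N}) (k : nat) (i j : 'I_N) (V : set R) : Prop :=
  if norm_g S C0 k i != 0 then
    V ((norm_g S C0 k i)^-1 *
       \sum_(r in C0) S k j r * s (ell - k - 1)%N i j)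
  else arbitrary V.

(* The conditional law given E of the trajectories of theta that comply with
   the observations is the product of v (the law at time ell) and of the
   transition matrices Pm k (from time k+1 to time k). *)
Definition describes_given d (T : measurableType d) (R : realType)
    (P : probability T R) (N : nat) (theta : nat -> T -> 'I_N) (E : set T)
    (ell : nat) (C0 Cl : {set 'I_N}) (Pm : nat -> 'M[R]_N) (v : 'rV[R]_N) :
    Prop :=
  forall x : nat -> 'I_N, x 0%N \in C0 -> x ell \in Cl ->
    cprob P [set t | forall k, (k <= ell)%N -> theta k t = x k] E
      (v ord0 (x ell) * \prod_(k < ell) Pm k (x k.+1) (x k)).

(* Main.v *)
Require Import Defs.
From mathcomp Require Import all_boot all_order all_algebra.
From mathcomp Require Import all_classical all_reals all_analysis.
Set Implicit Arguments.
Unset Strict Implicit.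
Unset Printing Implicit Defensive.
Import Order.TTheory GRing.Theory Num.Theory.
Local Open Scope classical_set_scope.
Local Open Scope ring_scope.

(** Everything rests on reading a conditional probability multiplicatively: for
measurable events, x is a value of P(A | B) if and only if P(A and B) = x P(B)
([cprobP]). When P(B) = 0 both sides vanish, so identities in this form hold
whatever values are assigned to the arbitrary quantities, including the rows of
the transition matrices at states of probability zero.

The Markov property, which is given for full histories of the chain, extends to
every event A that depends on the times 0, ..., m only and lies in
{eta m = i}, because A is a finite disjoint union of histories
([past_step]). Iterating it up to time ell gives, with m + k + 1 = ell,
  P(A, eta ell in C0) = P(A) g_i(k)    and
  P(A, eta (m+1) = j, eta ell in C0)
    = P(A) s_ij(m) (sum over r in C0 of [S^k]_jr)
([past_final_in], [past_step_final]). For A = {eta m = i, eta 0 in Cl} the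
quotient of these two is the bridge formula, and it holds at once for every
k < ell ([backward_bridge]); this gives the first two claims. For a general A
contained in {eta 0 in Cl}, the factor P(A) cancels: given the observations,
the reversed step does not see more of the later values of theta than the last
one ([backward_markov]). Multiplying these steps gives the conditional law of
the trajectories ([prob_trajectory]). The first formula, started
from {eta 0 = i}, yields the law of theta ell and the identity e = P(E) ([prob_extremes]), and the Chapman-Kolmogorov equation is
total probability over theta (k+1) ([chapman_kolmogorov]). The remaining
claims say that some event is null or empty. *)

(** * Finite additivity and the multiplicative form of conditioning *)

Section FiniteProbability.
Context (d : measure_display) (T : measurableType d) (R : realType).
Context (P : probability T R).

Local Notation Pr A := (fine (P A)).

Lemma prob_neq0 (A : set T) : measurable A -> (P A != 0%E) = (Pr A != 0).
Proof. by move=> mA; rewrite -{1}[P A]fineK ?fin_num_measure. Qed.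

Lemma prob_mono (A B : set T) :
  measurable A -> measurable B -> A `<=` B -> Pr A <= Pr B.
Proof.
move=> mA mB AB; apply: fine_le; rewrite ?fin_num_measure//.
by apply: le_measure; rewrite ?inE.
Qed.

Lemma prob_sub0 (A B : set T) :
  measurable A -> measurable B -> A `<=` B -> Pr B = 0 -> Pr A = 0.
Proof.
move=> mA mB AB B0; apply/eqP; rewrite eq_le -{1}B0 prob_mono//=.
by rewrite fine_ge0// measure_ge0.
Qed.

(** Also valid when B is null, since then both sides of the equation are zero:
this is what absorbs the arbitrary values. *)
Lemma cprobP (A B : set T) (x : R) : measurable A -> measurable B ->
  cprob P A B x <-> Pr (A `&` B) = x * Pr B.
Proof.
move=> mA mB; rewrite /cprob /= prob_neq0//.
have [B0|B0] := eqVneq (Pr B) 0.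
  rewrite B0 mulr0; split => // _.
  by apply: (prob_sub0 _ mB _ B0) => //; exact: measurableI.
split=> [-> //|->]; first by rewrite divfK.
by rewrite mulfK.
Qed.

Lemma cprob_null (A B : set T) :
  measurable B -> Pr B = 0 -> arbitrary (cprob P A B).
Proof.
move=> mB B0; apply/seteqP; split => // x _.
by rewrite /cprob /= prob_neq0// B0 eqxx.
Qed.

(** Measurability of the union is proved along with the sum because the
induction step needs it to apply additivity. *)
Lemma total_probability_seq (I : eqType) (f : T -> I) (r : seq I) (A : set T) :
  (forall i, measurable [set t | f t = i]) -> measurable A -> uniq r ->
  measurable [set t | f t \in r] /\
  Pr (A `&` [set t | f t \in r]) = \sum_(i <- r) Pr (A `&` [set t | f t = i]).
Proof.
move=> mf mA; elim: r => [|i r IH] /=.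
  rewrite big_nil; have -> : [set t | f t \in [::]] = set0.
    by apply/seteqP; split.
  by rewrite setI0 measure0.
case/andP => ir /IH[mr IHr]; rewrite big_cons.
have -> : [set t | f t \in i :: r] = [set t | f t = i] `|` [set t | f t \in r].
  apply/seteqP; split => t /=; rewrite inE.
    by case/orP => [/eqP|]; [left|right].
  by case=> [->|->]; rewrite ?eqxx ?orbT.
split; first exact: measurableU.
rewrite setIUr measureU; [|exact: measurableI|exact: measurableI|].
  rewrite fineD ?IHr// fin_num_measure//; exact: measurableI.
apply/seteqP; split => // t /= [[_ ->] [_ ir']].
by rewrite ir' in ir.
Qed.

Lemma total_probability_mem (I : finType) (f : T -> I) (C : {set I})
    (A : set T) :
  (forall i, measurable [set t | f t = i]) -> measurable A ->
  Pr (A `&` [set t | f t \in C]) = \sum_(i in C) Pr (A `&` [set t | f t = i]).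
Proof.
move=> mf mA; have [_] := total_probability_seq mf mA (enum_uniq C).
rewrite big_enum /= => <-; congr (Pr (_ `&` _)).
by apply/seteqP; split => t /=; rewrite mem_enum.
Qed.

Lemma total_probability (I : finType) (f : T -> I) (A : set T) :
  (forall i, measurable [set t | f t = i]) -> measurable A ->
  Pr A = \sum_i Pr (A `&` [set t | f t = i]).
Proof.
move=> mf mA; have [_] := total_probability_seq mf mA (enum_uniq I).
rewrite big_enum /= => <-; congr (Pr _).
by apply/seteqP; split => t /= => [At|[]//]; rewrite mem_enum.
Qed.

End FiniteProbability.

(** * The Markov property for events of the past *)

Section MarkovChain.
Context (d : measure_display) (T : measurableType d) (R : realType).
Context (P : probability T R) (N : nat) (eta : nat -> T -> 'I_N).
Context (s S : nat -> 'M[R]_N) (ell : nat).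
Context (eta_markov : markov_chain P eta).
Context (s_trans : transition_probabilities P eta s).
Context (S_trans : transitions_up_to P eta ell S).

Local Notation Pr A := (fine (P A)).
Local Notation at_ k i := [set t | eta k t = i].
Local Notation in_ k C := [set t | eta k t \in C].

(** The events of the sigma-algebra generated by eta 0, ..., eta m. Since the
state space is finite, closure under agreement of the first values is enough
and measurability follows ([measurable_past]). *)
Definition past_event (m : nat) (A : set T) : Prop :=
  forall t t', (forall n, (n <= m)%N -> eta n t = eta n t') -> A t -> A t'.

Definition prefix_path (m : nat) (t : T) : {ffun 'I_m.+1 -> 'I_N} :=
  [ffun n : 'I_m.+1 => eta n t].

Lemma prefix_pathP m t t' : prefix_path m t = prefix_path m t' <->
  forall n, (n <= m)%N -> eta n t = eta n t'.
Proof.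
split=> [/ffunP tt' n|tt'].
  by rewrite -ltnS => nm; have := tt' (Ordinal nm); rewrite !ffunE.
by apply/ffunP => n; rewrite !ffunE tt'// -ltnS.
Qed.

Lemma measurable_at k i : measurable (at_ k i).
Proof. by case: eta_markov. Qed.

Lemma measurable_prefix_path m f : measurable [set t | prefix_path m t = f].
Proof.
have -> : [set t | prefix_path m t = f] =
    \bigcap_(n in [set: 'I_m.+1]) at_ n (f n).
  apply/seteqP; split => t /= => [<- n _ /=|ft]; first by rewrite ffunE.
  by apply/ffunP => n; rewrite ffunE; exact: ft.
by apply: fin_bigcap_measurable => // n _; exact: measurable_at.
Qed.

(** The event is the union of the finitely many prefixes that it contains. *)
Lemma measurable_past m A : past_event m A -> measurable A.
Proof.
move=> pA; have -> : A = \bigcup_(f in [set f | exists2 t, A t &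
    prefix_path m t = f]) [set t | prefix_path m t = f].
  apply/seteqP; split => [t At|t' [_ [t At <-]] /= /esym/prefix_pathP tt'].
    by exists (prefix_path m t) => //; exists t.
  exact: pA At.
by apply: fin_bigcup_measurable => // f _; exact: measurable_prefix_path.
Qed.

Lemma past_at k m i : (k <= m)%N -> past_event m (at_ k i).
Proof. by move=> km t t' /(_ k km) /= ->. Qed.

Lemma past_in k m (C : {set 'I_N}) : (k <= m)%N -> past_event m (in_ k C).
Proof. by move=> km t t' /(_ k km) /= ->. Qed.

Lemma past_setI m A B :
  past_event m A -> past_event m B -> past_event m (A `&` B).
Proof.
by move=> pA pB t t' tt' [At Bt]; split; [exact: pA At|exact: pB Bt].
Qed.

Lemma past_extend m j A :
  past_event m A -> past_event m.+1 (A `&` at_ m.+1 j).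
Proof.
move=> pA; apply: past_setI; last exact: past_at.
by move=> t t' tt'; apply: pA => n nm; apply: tt'; exact: leqW.
Qed.

(** If the history is not null, neither is its last state, so that both the
Markov property and the value of s are binding; otherwise both sides are
zero. *)
Lemma history_step m (x : nat -> 'I_N) j :
  let history := [set t | forall n, (n <= m)%N -> eta n t = x n] in
  Pr (at_ m.+1 j `&` history) = Pr history * s m (x m) j.
Proof.
move=> history.
have mh : measurable history.
  apply: (@measurable_past m) => t t' tt' ht n nm.
  by rewrite -tt'// ht.
have hx : history `<=` at_ m (x m) by move=> t; apply.
have [h0|h0] := eqVneq (Pr history) 0.
  rewrite h0 mul0r; apply: (prob_sub0 _ mh _ h0) => [|t []//].
  by apply: measurableI => //; exact: measurable_at.
have /= := eta_markov.2 m x j.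
rewrite -/history prob_neq0// => /(_ h0).
have /cprobP -> := @s_trans m (x m) j; try exact: measurable_at.
rewrite mulfK; first by move=> <-; rewrite mulrC divfK.
by apply: contra_neq h0; apply: prob_sub0 => //; exact: measurable_at.
Qed.

(** Cut along the prefixes of length m: each piece of A is empty or one full
history, to which [history_step] applies. *)
Lemma past_step m A i j : past_event m A -> A `<=` at_ m i ->
  Pr (A `&` at_ m.+1 j) = Pr A * s m i j.
Proof.
move=> pA Ai; have mA := measurable_past pA.
have mp := @measurable_prefix_path m.
rewrite (total_probability _ mp); last first.
  by apply: measurableI => //; exact: measurable_at.
rewrite [Pr A](total_probability _ mp)// mulr_suml.
apply: eq_bigr => f _; rewrite setIAC.
have [->|/set0P[t [At tf]]] := eqVneq (A `&` [set t | prefix_path m t = f]) set0.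
  by rewrite set0I measure0 mul0r.
have -> : A `&` [set t | prefix_path m t = f] =
    [set t' | forall n, (n <= m)%N -> eta n t' = eta n t].
  apply/seteqP; split => t' /= => [[_]|t't].
    by rewrite -tf => /prefix_pathP.
  split; first by apply: pA At => n nm; rewrite t't.
  by rewrite -tf; apply/prefix_pathP.
by rewrite setIC (history_step m (eta ^~ t)) (Ai t At).
Qed.

(** * The law of the final state given the past *)

(** The factor is left existential because the induction passes through states
that may have probability zero: there S is unconstrained and need not satisfy
the recursion that the factors satisfy. It is identified with S afterwards, in
[past_final], at states of positive probability. *)
Lemma past_final_ex k r i : exists q, forall m A,
  (m + k = ell)%N -> past_event m A -> A `<=` at_ m i ->
  Pr (A `&` at_ ell r) = Pr A * q.
Proof.
elim: k i => [|k IH] i.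
  exists (i == r)%:R => m A; rewrite addn0 => -> pA Ai.
  have [<-|ir] := eqVneq i r; first by rewrite mulr1 setIidl.
  rewrite mulr0 (_ : _ `&` _ = set0) ?measure0//.
  by apply/seteqP; split => t // [/Ai /= -> /eqP]; rewrite (negbTE ir).
(* Chapman-Kolmogorov: the first step, then the factors of the next time. *)
have [q hq] := choice IH.
exists (\sum_j s (ell - k.+1)%N i j * q j) => m A mk pA Ai.
have mE : m = (ell - k.+1)%N by rewrite -mk addnK.
have mA := measurable_past pA.
rewrite (total_probability _ (measurable_at m.+1)); last first.
  by apply: measurableI => //; exact: measurable_at.
rewrite mulr_sumr; apply: eq_bigr => j _.
rewrite setIAC (hq j m.+1) ?addSnnS//.
- by rewrite (past_step _ pA Ai) -mE mulrA.
- exact: past_extend.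
Qed.

(** The factor of [past_final_ex] does not depend on A, so the event
{eta m = i} alone determines it. *)
Lemma past_final m k A i r : (m + k = ell)%N ->
  past_event m A -> A `<=` at_ m i -> Pr (A `&` at_ ell r) = Pr A * S k i r.
Proof.
move=> mk pA Ai; have [q hq] := past_final_ex k r i.
have mA := measurable_past pA; have [A0|A0] := eqVneq (Pr A) 0.
  by rewrite (hq m)// A0 !mul0r.
rewrite (hq m)//; congr (_ * _).
have m0 : Pr (at_ m i) != 0.
  by apply: contra_neq A0; apply: prob_sub0 => //; exact: measurable_at.
have kl : (k <= ell)%N by rewrite -mk leq_addl.
have := S_trans.2 k i r kl; have -> : (ell - k)%N = m by rewrite -mk addnK.
move/cprobP; rewrite setIC (hq m)//; last exact: past_at.
rewrite mulrC => /(_ (measurable_at _ _) (measurable_at _ _)).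
exact: (mulIf m0).
Qed.

Lemma past_final_in m k A i (C : {set 'I_N}) : (m + k = ell)%N ->
  past_event m A -> A `<=` at_ m i ->
  Pr (A `&` in_ ell C) = Pr A * \sum_(r in C) S k i r.
Proof.
move=> mk pA Ai; rewrite (total_probability_mem _ _ (measurable_at ell)).
  by rewrite mulr_sumr; apply: eq_bigr => r _; exact: past_final mk pA Ai.
exact: measurable_past pA.
Qed.

Lemma past_step_final m k A i j (C : {set 'I_N}) : (m + k.+1 = ell)%N ->
  past_event m A -> A `<=` at_ m i ->
  Pr (A `&` at_ m.+1 j `&` in_ ell C) =
  Pr A * s m i j * \sum_(r in C) S k j r.
Proof.
move=> mk pA Ai; rewrite (@past_final_in m.+1 k _ j) ?addSnnS//.
- by rewrite (past_step _ pA Ai).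
- exact: past_extend.
Qed.

(** * The reversed chain given the observations at the extremes *)

Context (C0 Cl : {set 'I_N}).
Local Notation theta := (reversal eta ell).
Local Notation Eo := (extremes theta ell C0 Cl).

Lemma extremesE : Eo = in_ 0%N Cl `&` in_ ell C0.
Proof.
rewrite /extremes /reversal subn0 subnn.
by apply/seteqP; split => t [].
Qed.

Lemma measurable_theta k i : measurable [set t | theta k t = i].
Proof. exact: measurable_at. Qed.

Lemma measurable_trajectory (x : nat -> 'I_N) :
  measurable [set t | forall k, (k <= ell)%N -> theta k t = x k].
Proof.
apply: (@measurable_past ell) => t t' tt' xt k kl.
by rewrite /reversal -tt' ?leq_subr//; exact: xt.
Qed.

Lemma measurable_extremes : measurable Eo.
Proof.
rewrite extremesE; apply: (@measurable_past ell).
by apply: past_setI; exact: past_in.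
Qed.

Lemma measurable_theta_extremes k i :
  measurable ([set t | theta k t = i] `&` Eo).
Proof.
by apply: measurableI; [exact: measurable_theta|exact: measurable_extremes].
Qed.

Lemma theta_extremesE m k i : (m + k.+1 = ell)%N ->
  [set t | theta k.+1 t = i] `&` Eo =
  (at_ m i `&` in_ 0%N Cl) `&` in_ ell C0.
Proof.
move=> mk; have -> : theta k.+1 = eta m by rewrite /reversal -mk addnK.
by rewrite extremesE setIA.
Qed.

Lemma theta_step_extremesE m k i j : (m + k.+1 = ell)%N ->
  [set t | theta k t = j] `&` ([set t | theta k.+1 t = i] `&` Eo) =
  (at_ m i `&` in_ 0%N Cl) `&` at_ m.+1 j `&` in_ ell C0.
Proof.
move=> mk; rewrite (theta_extremesE _ mk).
have -> : theta k = eta m.+1 by rewrite /reversal -mk -addSnnS addnK.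
by rewrite setIA [X in X `&` _]setIC.
Qed.

Lemma past_start m i : past_event m (at_ m i `&` in_ 0%N Cl).
Proof. by apply: past_setI; [exact: past_at|exact: past_in]. Qed.

(** Both members of the conditional probability are P(eta m = i, eta 0 in Cl)
times a factor that depends on the future only. If the common factor is zero
the conditioning event is null and every value is admissible. *)
Lemma backward_bridge k i j : (k < ell)%N ->
  bridge_formula s S ell C0 k i j (backward_transition P theta Eo k i j).
Proof.
move=> kl; pose m := (ell - k.+1)%N.
have mk : (m + k.+1 = ell)%N by rewrite subnK.
have pA := @past_start m i.
have Ai : at_ m i `&` in_ 0%N Cl `<=` at_ m i by move=> t [].
have PB : Pr ([set t | theta k.+1 t = i] `&` Eo) =
    Pr (at_ m i `&` in_ 0%N Cl) * norm_g S C0 k i.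
  by rewrite (theta_extremesE _ mk) (past_final_in _ mk pA Ai).
rewrite /bridge_formula; case: ifPn => [g0|/negPn/eqP g0].
  apply/cprobP; [exact: measurable_theta|exact: measurable_theta_extremes|].
  rewrite PB (theta_step_extremesE _ _ mk) (past_step_final _ _ mk pA Ai).
  rewrite -mulr_suml -subnDA addn1 -/m.
  rewrite [_ * norm_g _ _ _ _]mulrC mulrACA mulVf// mul1r.
  by rewrite -mulrA mulrC [s _ _ _ * _]mulrC.
apply: cprob_null; first exact: measurable_theta_extremes.
by rewrite PB g0 mulr0.
Qed.

(** By [past_step_final] and [past_final_in] both sides are P(A) times a
quantity that does not depend on A, so the equation for A follows from the one
for {eta m = i, eta 0 in Cl}, which is what the hypothesis on b says. If that
event is null, so is A. *)
Lemma backward_markov m k A i j b : (m + k.+1 = ell)%N ->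
  past_event m A -> A `<=` at_ m i -> A `<=` in_ 0%N Cl ->
  backward_transition P theta Eo k i j b ->
  Pr (A `&` at_ m.+1 j `&` in_ ell C0) = Pr (A `&` in_ ell C0) * b.
Proof.
move=> mk pA Ai ACl /cprobP pb.
have {}pb := pb (measurable_theta _ _) (measurable_theta_extremes _ _).
have ps := @past_start m i.
have si : at_ m i `&` in_ 0%N Cl `<=` at_ m i by move=> t [].
move: pb; rewrite (theta_step_extremesE _ _ mk) (theta_extremesE _ mk).
rewrite !(past_step_final _ _ mk _ si)// !(past_final_in _ mk _ si)//.
rewrite (past_step_final _ _ mk pA Ai) (past_final_in _ mk pA Ai).
have [A0|A0] := eqVneq (Pr A) 0; first by rewrite A0 !mul0r.
have s0 : Pr (at_ m i `&` in_ 0%N Cl) != 0.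
  apply: contra_neq A0; apply: prob_sub0.
  - exact: measurable_past pA.
  - exact: measurable_past ps.
  - by move=> t At; split; [exact: Ai|exact: ACl].
rewrite -!mulrA [b * _]mulrC -[_ * b]mulrA => /(mulfI s0) ->.
by rewrite mulrA.
Qed.

Lemma prob_initial_extremes i : i \in Cl ->
  Pr ([set t | theta ell t = i] `&` Eo) =
  \sum_(j in C0) S ell i j * distribution_at P eta 0%N i.
Proof.
move=> iCl; rewrite extremesE.
have -> : theta ell = eta 0%N by rewrite /reversal subnn.
rewrite setIA [X in X `&` _]setIidl; last by move=> t /= ->.
rewrite (@past_final_in 0 ell _ i)//; last exact: past_at.
by rewrite mulr_sumr; apply: eq_bigr => j _; rewrite mulrC.
Qed.

Lemma prob_extremes :
  Pr Eo = norm_e S (distribution_at P eta 0%N) ell C0 Cl.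
Proof.
have -> : Eo = Eo `&` [set t | theta ell t \in Cl].
  by rewrite setIidl// => t [].
rewrite (total_probability_mem _ _ (measurable_theta ell)); last first.
  exact: measurable_extremes.
by apply: eq_bigr => i iCl; rewrite setIC prob_initial_extremes.
Qed.

(** The conclusion says that w *m M gives the conditional law at time k, with the
denominator cleared so that it remains meaningful when Eo is null. *)
Lemma chapman_kolmogorov k j (w : 'rV[R]_N) (M : 'M[R]_N) :
  (forall i, backward_transition P theta Eo k i j (M i j)) ->
  (forall i, conditional_distribution P theta Eo k.+1 i (w ord0 i)) ->
  Pr ([set t | theta k t = j] `&` Eo) = (w *m M) ord0 j * Pr Eo.
Proof.
move=> pM piw; rewrite mxE mulr_suml.
rewrite (total_probability _ (measurable_theta k.+1)); last first.
  exact: measurable_theta_extremes.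
apply: eq_bigr => i _.
have /cprobP := pM i.
move=> /(_ (measurable_theta _ _) (measurable_theta_extremes _ _)).
have /cprobP -> := piw i; [|exact: measurable_theta|exact: measurable_extremes].
by rewrite -setIA [Eo `&` _]setIC => ->; rewrite mulrA [M i j * _]mulrC.
Qed.

(** Induction on the number m of steps of eta that have been revealed, that is,
downwards in the time of theta. Each step is an instance of [backward_markov]
for the event A m that eta has followed the reversed trajectory up to time m;
once A m is null all later terms vanish on both sides. *)
Lemma prob_trajectory (x : nat -> 'I_N) (M : nat -> 'M[R]_N) (v : 'rV[R]_N) :
  x 0%N \in C0 -> x ell \in Cl ->
  (forall k, (k < ell)%N ->
     backward_transition P theta Eo k (x k.+1) (x k) (M k (x k.+1) (x k))) ->
  conditional_distribution P theta Eo ell (x ell) (v ord0 (x ell)) ->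
  Pr ([set t | forall k, (k <= ell)%N -> theta k t = x k] `&` Eo) =
  v ord0 (x ell) * \prod_(k < ell) M k (x k.+1) (x k) * Pr Eo.
Proof.
move=> x0 xl pM piv; pose y m := x (ell - m)%N.
pose A m := [set t | forall n, (n <= m)%N -> eta n t = y n].
have pA m : past_event m (A m) by move=> t t' tt' At n nm; rewrite -tt'// At.
have Ay m : A m `<=` at_ m (y m) by move=> t; apply.
have A0 m : A m `<=` in_ 0%N Cl by move=> t /(_ _ (leq0n _)) /= ->; rewrite /y subn0.
have ASm m : A m.+1 = A m `&` at_ m.+1 (y m.+1).
  apply/seteqP; split => t /= => [At|[At At1] n].
    by split => [n nm|]; apply: At => //; exact: leqW.
  by rewrite leq_eqVlt => /predU1P[-> //|]; rewrite ltnS; exact: At.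
have PA m : (m <= ell)%N -> Pr (A m `&` in_ ell C0) = v ord0 (x ell) * Pr Eo *
    \prod_(n < m) M (ell - n.+1)%N (x (ell - n.+1).+1) (x (ell - n.+1)%N).
  elim: m => [_|m IH ml].
    rewrite big_ord0 mulr1.
    have /cprobP <- := piv; [|exact: measurable_theta|exact: measurable_extremes].
    rewrite extremesE; have -> : theta ell = eta 0%N by rewrite /reversal subnn.
    rewrite setIA; congr (Pr (_ `&` _)); apply/seteqP; split => t.
      move=> At; split; last exact: A0 At.
      by have := At 0%N isT; rewrite /y subn0.
    by move=> [/= t0 _] n; rewrite leqn0 => /eqP ->; rewrite /y subn0.
  rewrite big_ord_recr /= mulrA -IH ?(ltnW ml)// ASm.
  have kS : (ell - m.+1).+1 = (ell - m)%N by rewrite subnSK.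
  apply: (@backward_markov m (ell - m.+1)); [|exact: pA|exact: Ay|exact: A0|].
    by rewrite kS subnKC// ltnW.
  have kl : (ell - m.+1 < ell)%N.
    by rewrite ltn_subrL (leq_ltn_trans (leq0n m) ml).
  by have := pM _ kl; rewrite kS.
rewrite mulrAC (reindex_inj rev_ord_inj) -PA//; congr (Pr _).
rewrite extremesE setIA; apply/seteqP; split => t /= [].
  move=> [xt _] tC; split => // n nl.
  by rewrite /y -xt ?leq_subr// /reversal subKn.
move=> At tC; split=> //; split; last exact: (A0 ell).
by move=> k kl; rewrite /reversal At ?leq_subr// /y subKn.
Qed.

End MarkovChain.

Theorem lemma1 (d : measure_display) (T : measurableType d) (R : realType)
    (P : probability T R) (N : nat) (eta : nat -> T -> 'I_N)
    (s S : nat -> 'M[R]_N) (ell : nat) (C0 Cl : {set 'I_N})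
    (eta_markov : markov_chain P eta)
    (s_trans : transition_probabilities P eta s)
    (S_trans : transitions_up_to P eta ell S) :
  let upsilon := distribution_at P eta in
  let theta := reversal eta ell in
  let Eo := extremes theta ell C0 Cl in
  let p := backward_transition P theta Eo in
  let pi := conditional_distribution P theta Eo in
  let e := norm_e S (upsilon 0%N) ell C0 Cl in
  let star k i j := bridge_formula s S ell C0 k i j (p k i j) in
  (* 1 *)
  (forall k i j, (1 <= k)%N -> (k + 2 <= ell)%N ->
     (0 < upsilon (ell - k - 1)%N i -> star k i j) /\
     (upsilon (ell - k - 1)%N i = 0 -> arbitrary (p k i j))) /\
  (* 2 *)
  ((0 < ell)%N ->
     (forall i j, i \in Cl -> star (ell - 1)%N i j) /\
     (forall i j, j \in C0 -> star 0%N i j)) /\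
  (* 3 *)
  ((0 < ell)%N ->
     (forall i j, i \notin Cl -> arbitrary (p (ell - 1)%N i j)) /\
     (forall i j, i \in Cl ->
        cprob P [set t | eta ell t \in C0] [set t | eta 0%N t = i] 0 ->
        arbitrary (p (ell - 1)%N i j)) /\
     (forall i j, j \notin C0 -> p 0%N i j 0) /\
     (forall (Pm : nat -> 'M[R]_N) (v : 'rV[R]_N),
        (forall k i j, (k < ell)%N -> ~ (k = 0%N /\ j \notin C0) ->
           p k i j (Pm k i j)) ->
        (forall i, pi ell i (v ord0 i)) ->
        describes_given P theta Eo ell C0 Cl Pm v)) /\
  (* 4 *)
  ((forall i, i \in Cl ->
      if e != 0 then
        pi ell i (e^-1 * \sum_(j in C0) S ell i j * upsilon 0%N i)
      else arbitrary (pi ell i)) /\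
   (forall i, i \notin Cl -> pi ell i 0)) /\
  (* 5 *)
  (forall (Pm : nat -> 'M[R]_N) (v : nat -> 'rV[R]_N),
     (forall k i j, (1 <= k)%N -> (k + 1 <= ell)%N -> p k i j (Pm k i j)) ->
     (forall i, pi ell i (v ell ord0 i)) ->
     (e != 0 ->
      (forall k i, (1 <= k)%N -> (k + 1 <= ell)%N -> pi k i (v k ord0 i)) ->
      forall k, (1 <= k)%N -> (k + 1 <= ell)%N -> v k = v k.+1 *m Pm k) /\
     ((forall k, (1 <= k)%N -> (k + 1 <= ell)%N -> v k = v k.+1 *m Pm k) ->
      forall k i, (1 <= k)%N -> (k + 1 <= ell)%N -> pi k i (v k ord0 i))).
Proof.
move=> upsilon theta Eo p pi e star.
have star_holds k i j : (k < ell)%N -> star k i j.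
  exact: backward_bridge.
have mEo : measurable Eo by exact: (measurable_extremes ell eta_markov).
have mt k i : measurable [set t | theta k t = i].
  exact: (measurable_theta ell eta_markov).
have mtE k i : measurable ([set t | theta k t = i] `&` Eo).
  exact: measurableI.
have eE : fine (P Eo) = e.
  exact: (prob_extremes eta_markov s_trans S_trans).
have null_state k i j : fine (P [set t | theta k.+1 t = i]) = 0 ->
    arbitrary (p k i j).
  by move=> i0; apply: cprob_null => //; apply: prob_sub0 i0.
split; [|split; [|split; [|split]]].
- move=> k i j k1 kl; split => [_|i0].
    by apply: star_holds; rewrite (leq_trans _ kl)// addn2.
  by apply: null_state; move: i0; rewrite /upsilon -subnDA addn1.
- move=> l0; split => i j _; apply: star_holds => //.
  by rewrite subn1 prednK.
- move=> l0; have lE : ((ell - 1).+1 = ell)%N by rewrite subn1 prednK.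
  have theta_ell : theta ell = eta 0%N by rewrite /theta /reversal subnn.
  have theta_0 : theta 0%N = eta ell by rewrite /theta /reversal subn0.
  split; [|split; [|split]].
  + move=> i j iCl; apply: cprob_null => //; rewrite lE.
    rewrite (_ : _ `&` _ = set0) ?measure0//.
    by apply/seteqP; split => // t [ti [_ tC]]; case/negP: iCl; rewrite -ti.
  + move=> i j iCl; have mC : measurable [set t | eta ell t \in C0].
      by apply: (@measurable_past _ _ _ _ _ _ eta_markov ell); exact: past_in.
    move/cprobP => /(_ mC); rewrite mul0r -theta_ell => /(_ (mt _ _)) i0.
    apply: cprob_null => //; rewrite lE; apply: prob_sub0 i0 => //.
      exact: measurableI.
    by move=> t [ti [tC _]]; rewrite -theta_0; split.
  + move=> i j jC0; apply/cprobP => //; rewrite mul0r.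
    rewrite (_ : _ `&` _ = set0) ?measure0//.
    by apply/seteqP; split => // t [tj [_ [tC _]]]; case/negP: jC0; rewrite -tj.
  + move=> Pm v pPm piv x x0 xl; apply/cprobP => //.
      exact: (measurable_trajectory ell eta_markov).
    apply: (prob_trajectory eta_markov s_trans S_trans) => //; last exact: piv.
    by move=> k kl; apply: pPm => // -[k0]; rewrite k0 x0.
- split=> i iCl.
    case: ifPn => [e0|/negPn/eqP e0]; last first.
      by apply: cprob_null => //; rewrite -e0.
    apply/cprobP => //; rewrite eE mulrAC mulVf// mul1r.
    exact: prob_initial_extremes.
  apply/cprobP => //; rewrite mul0r (_ : _ `&` _ = set0) ?measure0//.
  by apply/seteqP; split => // t [ti [_ tC]]; case/negP: iCl; rewrite -ti.
- move=> Pm v pPm piv; have ck k j : (1 <= k)%N -> (k + 1 <= ell)%N ->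
      (forall i, pi k.+1 i (v k.+1 ord0 i)) ->
      fine (P ([set t | theta k t = j] `&` Eo)) =
      (v k.+1 *m Pm k) ord0 j * fine (P Eo).
    move=> k1 kl piS; apply: (chapman_kolmogorov eta_markov) piS => // i.
    exact: pPm.
  split=> [e0 pik k k1 kl|vE k i k1 kl].
    apply/rowP => j; apply: (mulIf e0); rewrite -eE -ck//.
      by apply/esym/cprobP => //; exact: pik.
    (* The law at time k + 1 is given by piv if k + 1 = ell, else by pik. *)
    move=> i; have := kl; rewrite addn1 leq_eqVlt => /predU1P[-> //|kl'].
    by apply: pik => //; rewrite addn1.
  (* From the known law at time ell downwards: induction on ell - k. *)
  have [n] := ubnP (ell - k); elim: n k i k1 kl => // n IH k i k1 kl kn.
  apply/cprobP => //; rewrite vE// ck// => i'.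
  have := kl; rewrite addn1 leq_eqVlt => /predU1P[-> //|kl'].
  apply: IH => //; first by rewrite addn1.
  by rewrite subnS prednK // subn_gt0 ltnW.
Qed.
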